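(* Let $\alpha>0$, let $q$ be a complex number with $0<|q|<1$, and let $\{f_n\}_{n=0}^{\infty}\subset\mathbb{C}$ satisfy $\sup_{n\ge0}|f_n|<\infty$ and $\sup\{n:f_n\ne0\}=\infty$. Let $f$ be the entire function $$f(z)=\sum_{n=0}^{\infty}f_n q^{\alpha n^2}z^n .$$ Then $f$ has infinitely many nonzero roots $\{\rho_n\}_{n\in\mathbb{N}}$, which can be arranged so that $0<|\rho_1|\le|\rho_2|\le\cdots\le|\rho_n|\le\cdots$. Moreover, for any number $C$ satisfying $$C>-\frac{1}{4\alpha\log|q|}>0$$ and any $\eta$ with $0<\eta<1$, there exists a positive integer $N$ such that $$|\rho_n|\ge e^{C(\eta,C)\,n},\qquad\forall n\ge N,$$ where $$C(\eta,C)=\frac{(1-\eta)\eta^{2}}{C}.$$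
   Context: A fixed branch of $\log q$ is used to define $q^{\beta}=e^{\beta\log q}$ for real $\beta$, so $|q^{\beta}|=|q|^{\beta}$. The roots $\rho_n$ are the nonzero zeros of $f$, repeated according to multiplicity and indexed by $n=1,2,3,\dots$ in order of nondecreasing modulus. *)

(* Defs.v *)
From HB Require Import structures.
From mathcomp Require Import all_boot all_order all_algebra.
From mathcomp Require Import complex.
From mathcomp Require Import all_classical all_reals all_analysis.

Set Implicit Arguments.
Unset Strict Implicit.
Unset Printing Implicit Defensive.

Import Order.TTheory GRing.Theory Num.Theory.
Import numFieldNormedType.Exports.

Local Open Scope classical_set_scope.
Local Open Scope ring_scope.
Local Open Scope complex_scope.

(* The complex numbers. MathComp-Analysis attaches the topology of a field K
   to its alias K^o, hence [R[i]^o] rather than [R[i]]; the modulus of z as an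
   element of R is [Normc.normc z], and [`|z| = (Normc.normc z)%:C]. *)
Notation Cplx R := (R[i]^o).

Definition cexp (R : realType) (z : Cplx R) : Cplx R :=
  (expR (complex.Re z))%:C * (cos (complex.Im z) +i* sin (complex.Im z)).

(* q^b := e^(b log q) for real b, where [logq] is the chosen value of log q
   (so that cexp logq = q). *)
Definition cpow (R : realType) (logq : Cplx R) (b : R) : Cplx R :=
  cexp (b%:C * logq).

(* f(z) = \sum_(n >= 0) fc n * q^(alpha n^2) * z^n. [lim] is total; when
   |q| < 1, 0 < alpha and [fc] is bounded the series converges for every z. *)
Definition qseries (R : realType) (alpha : R) (logq : Cplx R)
    (fc : nat -> Cplx R) (z : Cplx R) : Cplx R :=
  limn (series (fun n : nat =>
    fc n * cpow logq (alpha * n%:R ^+ 2) * z ^+ n : Cplx R)).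

(* a is a zero of f of multiplicity m: near a, f(z) = (z - a)^m g(z) with g
   holomorphic and g(a) != 0 (m = 0 means f(a) != 0). Derivability over the
   field R[i] is complex derivability. *)
Definition zero_multiplicity (R : realType) (f : Cplx R -> Cplx R)
    (a : Cplx R) (m : nat) : Prop :=
  exists g : Cplx R -> Cplx R,
    [/\ g a != 0,
        \forall z \near a, derivable g z 1 &
        \forall z \near a, f z = (z - a) ^+ m * g z].

(* rho 1, rho 2, ... lists the nonzero zeros of f, each repeated according to
   its multiplicity, by nondecreasing modulus; rho 0 is irrelevant. Points a
   with f(a) != 0 have multiplicity 0 and thus do not occur in the list. *)
Definition nonzero_roots_arranged (R : realType) (f : Cplx R -> Cplx R)
    (rho : nat -> Cplx R) : Prop :=
  [/\ forall n : nat, (0 < n)%N -> 0 < Normc.normc (rho n),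
      forall a : Cplx R, a != 0 ->
        exists2 m : nat, zero_multiplicity f a m &
          ([set n : nat | (0 < n)%N /\ rho n = a] #= `I_m)%card &
      forall n : nat, (0 < n)%N ->
        Normc.normc (rho n) <= Normc.normc (rho n.+1)].

Definition growth_rate (R : realType) (eta C : R) : R :=
  (1 - eta) * eta ^+ 2 / C.

(* Main.v *)
Require Import Defs.
From HB Require Import structures.
From mathcomp Require Import all_boot all_order all_algebra.
From mathcomp Require Import complex.
From mathcomp Require Import all_classical all_reals all_analysis.
From mathcomp Require Import ring lra zify.

Set Implicit Arguments.
Unset Strict Implicit.
Unset Printing Implicit Defensive.

Import Order.TTheory GRing.Theory Num.Theory.
Import numFieldNormedType.Exports.

Local Open Scope classical_set_scope.
Local Open Scope ring_scope.

(** Write f(z) = z^m * sum_n c_n z^n with c_0 <> 0. With g = alpha log(1/|q|)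
    the coefficients satisfy |c_n| <= M exp(- g n^2), so f has order zero, and
    the whole proof works on coefficient sequences: neither contour integrals
    nor a logarithm of f occur.

    Division. When sum_n c_n z^n vanishes at b, its quotient by z - b has the
    coefficients d_n = sum_k c_(n+1+k) b^k, and c_(n+1) = d_n - b d_(n+1). For
    the weighted norm |c|_r = sup_n |c_n| r^n this recurrence gives
    r |d|_r <= |c|_r + |b| |d|_r, so that dividing by z - b costs a factor
    1 / (r - |b|) at most ([quot_le]). Dividing by all members of a list of
    zeros of modulus < r yields
      |c_0| prod (r - |a|) <= |c|_r prod |a|,
    which is [jensen]; it does the work of Jensen's formula here. The same
    factorisation f(z) = f(b) + (z - b) g(z) gives continuity and complex
    differentiability of f.

    Existence of zeros. If a series of order at most 1/2 has no zero, the roots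
    of its partial sums p_N leave every disc as N grows. By [jensen] the number
    of roots of p_N of modulus <= 4^j is at most G 2^j with G independent of
    N, hence S_N = sum 1/|a| over the roots a of p_N tends to 0. The k-th
    coefficient of p_N = c_0 prod (1 - z/a) is bounded by |c_0| S_N^k, so c_k
    = 0 for every k > 0 ([zero_free_const]).

    Arrangement. Dividing a series with infinitely many nonzero coefficients
    by z - a keeps it such a series, so one can remove a zero of least modulus
    again and again. The removed zeros have nondecreasing moduli, unbounded by
    [jensen]; each point is therefore removed finitely often, and as often as
    its multiplicity tells ([sorted_root_arranged]).

    Growth. Suppose that n zeros have modulus at most e^(kn). With r = e^(2kn)
    one has |c|_r <= M exp(k^2 n^2 / g), and [jensen] becomes
      |c_0| (e^(kn) - 1)^n <= M exp(k^2 n^2 / g),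
    impossible for large n when k < g ([gaussian_zeros]). The rate
    k = (1 - eta) eta^2 / C is admissible, as (1 - eta) eta^2 <= 1/4 and
    1 / C < 4 g. *)

(** * The modulus as a real number *)

Local Notation normc := Normc.normc.

Lemma normc_real (R : realType) (z : Cplx R) : `|z| = (normc z)%:C%C.
Proof. by []. Qed.

Lemma modM (R : realType) (x y : Cplx R) : normc (x * y) = normc x * normc y.
Proof. exact: Normc.normcM. Qed.

Lemma modD (R : realType) (x y : Cplx R) : normc (x + y) <= normc x + normc y.
Proof. exact: (@le_normcD R). Qed.

Lemma modN (R : realType) (x : Cplx R) : normc (- x) = normc x.
Proof. exact: (@normcN R). Qed.

Lemma modB (R : realType) (x y : Cplx R) : normc (x - y) <= normc x + normc y.
Proof. by rewrite -(modN y) modD. Qed.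

Lemma mod_subC (R : realType) (x y : Cplx R) : normc (x - y) = normc (y - x).
Proof. by rewrite -modN opprB. Qed.

Lemma mod_ge0 (R : realType) (x : Cplx R) : 0 <= normc x.
Proof. by case: x => a b; rewrite /= sqrtr_ge0. Qed.

Lemma mod0 (R : realType) : normc (0 : Cplx R) = 0.
Proof. exact: Normc.normc0. Qed.

Lemma mod1 (R : realType) : normc (1 : Cplx R) = 1.
Proof. exact: Normc.normc1. Qed.

Lemma mod_eq0 (R : realType) (x : Cplx R) : (normc x == 0) = (x == 0).
Proof.
by apply/eqP/eqP => [/Normc.eq0_normc//|->]; rewrite mod0.
Qed.

Lemma mod_gt0 (R : realType) (x : Cplx R) : (0 < normc x) = (x != 0).
Proof. by rewrite lt_neqAle mod_ge0 andbT eq_sym mod_eq0. Qed.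

Lemma modV (R : realType) (x : Cplx R) : normc x^-1 = (normc x)^-1.
Proof. exact: Normc.normcV. Qed.

Lemma modX (R : realType) (x : Cplx R) n : normc (x ^+ n) = normc x ^+ n.
Proof. by elim: n => [|n IH]; rewrite ?expr0 ?mod1// !exprS modM IH. Qed.

Lemma mod_dist (R : realType) (x y : Cplx R) :
  `|normc x - normc y| <= normc (x - y).
Proof.
rewrite ler_norml; apply/andP; split.
  by have := modD x (y - x); rewrite (mod_subC y x) addrC subrK; lra.
by have := modD y (x - y); rewrite addrC subrK; lra.
Qed.

Lemma mod_ReIm (R : realType) (x : Cplx R) :
  normc x <= `|complex.Re x| + `|complex.Im x|.
Proof.
case: x => a b /=; rewrite -[leRHS]ger0_norm ?addr_ge0//.
rewrite -sqrtr_sqr ler_sqrt ?sqr_ge0//.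
rewrite -(real_normK (num_real a)) -(real_normK (num_real b)).
have := mulr_ge0 (normr_ge0 a) (normr_ge0 b); nra.
Qed.

Lemma Re_le_mod (R : realType) (x : Cplx R) : `|complex.Re x| <= normc x.
Proof.
by case: x => a b /=; rewrite -sqrtr_sqr ler_sqrt ?addr_ge0 ?sqr_ge0// lerDl sqr_ge0.
Qed.

Lemma Im_le_mod (R : realType) (x : Cplx R) : `|complex.Im x| <= normc x.
Proof.
by case: x => a b /=; rewrite -sqrtr_sqr ler_sqrt ?addr_ge0 ?sqr_ge0// lerDr sqr_ge0.
Qed.

(** The norm of [Cplx R] takes values in [R[i]]; this and [cvg_modP] turn its
    neighbourhoods into statements about the real modulus. *)
Lemma near_modP (R : realType) (a : Cplx R) (P : set (Cplx R)) :
  (\forall z \near a, P z) <->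
  exists2 e : R, 0 < e & forall z, normc (z - a) < e -> P z.
Proof.
split.
  move=> /nbhs_ballP[e /= e0 he].
  have eE : e = (complex.Re e)%:C%C by rewrite RRe_real// gtr0_real.
  have e0' : 0 < complex.Re e by rewrite eE ltcR in e0.
  exists (complex.Re e) => // z hz; apply: he.
  by rewrite -ball_normE /= distrC normc_real eE ltcR.
move=> [e e0 he]; apply/nbhs_ballP; exists e%:C%C; first by rewrite /= ltcR.
by move=> z; rewrite -ball_normE /= distrC normc_real ltcR => /he.
Qed.

Lemma cvg_modP (R : realType) (T : Type) (F : set_system T) (FF : Filter F)
    (u : T -> Cplx R) (l : Cplx R) :
  (forall e : R, 0 < e -> \forall x \near F, normc (u x - l) < e) -> u @ F --> l.
Proof.
move=> h P /near_modP[e e0 he].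
by rewrite /fmap/=; near=> x; apply: he; near: x; apply: h.
Unshelve. all: end_near. Qed.

(** * Series dominated by a geometric one *)

Section csum.
Context {R : realType}.
Implicit Types (u : nat -> Cplx R) (B : R).

Definition csum u : Cplx R := limn (series u).

Lemma seriesSn u n : series u n.+1 = series u n + u n.
Proof. by rewrite /series /= big_nat_recr. Qed.

Lemma series_partial u B (hu : forall n, normc (u n) <= B / 2 ^+ n) n k :
  normc (series u (n + k)%N - series u n) <= 2 * B / 2 ^+ n - 2 * B / 2 ^+ (n + k)%N.
Proof.
elim: k => [|k IH]; first by rewrite addn0 !subrr mod0.
rewrite addnS seriesSn addrAC (le_trans (modD _ _))//.
have := hu (n + k)%N; have -> : 2 * B / 2 ^+ (n + k).+1 = B / 2 ^+ (n + k) :> R.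
  by rewrite exprS; field; rewrite expf_neq0.
rewrite -mulrA in IH |- *; rewrite -mulrA in IH; lra.
Qed.

(** Convergence is obtained for the real and the imaginary part separately,
    from completeness of [R]; the explicit remainder is what later replaces
    limit arguments. *)
Lemma csum_geometric u B (hu : forall n, normc (u n) <= B / 2 ^+ n) :
  series u @ \oo --> csum u /\
  forall n, normc (csum u - series u n) <= 2 * B / 2 ^+ n.
Proof.
have B0 : 0 <= B by have := hu 0%N; rewrite divr1; exact/le_trans/mod_ge0.
have cvgR (v : R^nat) : (forall n, `|v n| <= B / 2 ^+ n) -> cvgn (series v).
  move=> hv; apply: normed_cvg; apply: (@series_le_cvg _ _ (geometric B 2^-1)) => //.
  - by move=> n /=.
  - by move=> n; rewrite /geometric /= mulr_ge0// exprn_ge0.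
  - by move=> n; rewrite /geometric /= exprVn.
  - by apply: is_cvg_geometric_series; rewrite ger0_norm//; lra.
pose l : Cplx R := (limn (series (fun n => complex.Re (u n))) +i*
                    limn (series (fun n => complex.Im (u n))))%C.
have cR : cvgn (series (fun n => complex.Re (u n))).
  by apply: cvgR => n; apply: le_trans (hu n); apply: Re_le_mod.
have cI : cvgn (series (fun n => complex.Im (u n))).
  by apply: cvgR => n; apply: le_trans (hu n); apply: Im_le_mod.
have cl : series u @ \oo --> l.
  apply: cvg_modP => e e0; near=> n.
  apply: (le_lt_trans (mod_ReIm _)).
  have -> : complex.Re (series u n - l) =
     series (fun n => complex.Re (u n)) n - limn (series (fun n => complex.Re (u n))).
    by rewrite raddfB /= /series /= raddf_sum.
  have -> : complex.Im (series u n - l) =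
     series (fun n => complex.Im (u n)) n - limn (series (fun n => complex.Im (u n))).
    by rewrite raddfB /= /series /= raddf_sum.
  rewrite (splitr e) ltrD//.
    by rewrite distrC; near: n; move/cvgrPdist_lt: cR; apply; rewrite divr_gt0.
  by rewrite distrC; near: n; move/cvgrPdist_lt: cI; apply; rewrite divr_gt0.
have E : csum u = l by apply: cvg_lim cl.
rewrite E; split=> // n; apply/ler_addgt0Pr => e e0.
have near_l : \forall z \near l, normc (z - l) < e by apply/near_modP; exists e.
have [m _ hm] := cl _ near_l.
have := hm (n + m)%N (leq_addl _ _); rewrite /= => h1.
have := series_partial hu n m.
have := modD (l - series u (n + m)%N) (series u (n + m)%N - series u n).
rewrite mod_subC in h1.
have -> : l - series u (n + m)%N + (series u (n + m)%N - series u n) = l - series u n by ring.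
have : 0 <= 2 * B / 2 ^+ (n + m)%N by rewrite divr_ge0 ?exprn_ge0// mulr_ge0.
lra.
Unshelve. all: end_near. Qed.

(** A rate of convergence is the convenient way to identify a sum, since all
    series below converge geometrically. *)
Lemma csum_unique u (l : Cplx R) B :
  (forall n, normc (series u n - l) <= B / 2 ^+ n) -> csum u = l.
Proof.
move=> h; apply: cvg_lim => //; apply: cvg_modP => e e0.
have [n0 _ hn0] : \forall n \near \oo, B / 2 ^+ n < e.
  have := @cvg_geometric R B 2^-1; rewrite ger0_norm; last lra.
  move=> /(_ ltac:(lra))/cvgrPdist_lt/(_ e e0)[n0 _ hn0]; exists n0 => // n /hn0.
  by rewrite /= sub0r normrN exprVn; apply/le_lt_trans/ler_norm.
by exists n0 => // n /hn0; apply: le_lt_trans.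
Qed.

Lemma csumZ u B (hu : forall n, normc (u n) <= B / 2 ^+ n) (a : Cplx R) :
  csum (fun n => a * u n) = a * csum u.
Proof.
have [_ h] := csum_geometric hu.
apply: (@csum_unique _ _ (normc a * (2 * B))) => n.
have -> : series (fun n => a * u n) n = a * series u n by rewrite /series /= mulr_sumr.
by rewrite -mulrBr modM mod_subC -mulrA ler_wpM2l ?mod_ge0.
Qed.

Lemma csum_recl u B (hu : forall n, normc (u n) <= B / 2 ^+ n) :
  csum u = u 0 + csum (fun n => u n.+1).
Proof.
have hv n : normc (u n.+1) <= (B / 2) / 2 ^+ n.
  by rewrite (le_trans (hu _))// exprS invfM mulrA.
have [_ h] := csum_geometric hu; have [_ h'] := csum_geometric hv.
have B0 : 0 <= B by have := hu 0; rewrite divr1; exact/le_trans/mod_ge0.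
apply: (@csum_unique _ _ (4 * B)) => n.
set w := csum _.
have -> : series u n - (u 0 + w) = (series u n.+1 - (u 0 + w)) - u n by rewrite seriesSn; ring.
have -> : series u n.+1 = u 0 + series (fun n => u n.+1) n.
  by rewrite /series /= big_nat_recl.
rewrite [_ + _ - (_ + _)](_ : _ = series (fun n => u n.+1) n - w); last by ring.
apply: le_trans (modB _ _) _; rewrite mod_subC.
have := h' n; have := hu n; rewrite -/w.
have : 0 <= B / 2 ^+ n by rewrite divr_ge0 ?exprn_ge0.
have -> : 2 * (B / 2) = B by field.
by rewrite -[4 * B / _]mulrA; lra.
Qed.

Lemma csum_le u B (hu : forall n, normc (u n) <= B / 2 ^+ n) :
  normc (csum u) <= 2 * B.
Proof.
have [_ /(_ 0%N)] := csum_geometric hu.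
by rewrite /series /= big_geq// subr0 divr1.
Qed.

End csum.

(** * Entire power series and division by a linear factor *)

Section PowerSeries.
Context {R : realType}.
Implicit Types (c : nat -> Cplx R) (b z : Cplx R) (r M : R).

Definition psum c z : Cplx R := csum (fun n => c n * z ^+ n).

(** Growth of order at most 1/2: the maximal term on the circle of radius 4^j is
    at most 2^(D 2^j), an exponential in the square root of the radius. Radii
    that are powers of 4 keep D and all later counting bounds in [nat]. *)
Definition slow c := exists D : nat,
  forall j n, normc (c n) * (4 ^+ j) ^+ n <= 2 ^+ (D * 2 ^ j)%N.

Lemma pow4_ge (x : R) : exists j : nat, x <= 4 ^+ j.
Proof.
exists (Num.Def.archi_bound `|x|); apply: le_trans (ler_norm x) _.
apply: le_trans (ltW (archi_boundP _)) _ => //.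
by rewrite -natrX ler_nat; apply: ltnW; exact: ltn_expl.
Qed.

(** Comparing with a circle of radius at least 2r leaves the factor 2^-n. *)
Lemma slow_geometric c r : slow c ->
  exists B, forall n, normc (c n) * r ^+ n <= B / 2 ^+ n.
Proof.
move=> [D hD]; have [j hj] := pow4_ge (2 * `|r|).
exists (2 ^+ (D * 2 ^ j)) => n.
rewrite ler_pdivlMr ?exprn_gt0// (le_trans _ (hD j n))// -mulrA.
rewrite ler_wpM2l ?mod_ge0// mulrC -exprMn (le_trans (ler_norm _))// normrX.
by rewrite lerXn2r ?nnegrE ?exprn_ge0// normrM ger0_norm.
Qed.

Lemma slow_term c r : slow c -> exists B, forall z, normc z <= r ->
  forall n, normc (c n * z ^+ n) <= B / 2 ^+ n.
Proof.
move=> /(@slow_geometric _ r)[B hB]; exists B => z hz n.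
apply: le_trans (hB n); rewrite modM modX ler_wpM2l ?mod_ge0//.
by rewrite lerXn2r ?nnegrE ?mod_ge0// (le_trans _ hz) ?mod_ge0.
Qed.

Lemma psum_bounded c r : slow c ->
  exists K, forall z, normc z <= r -> normc (psum c z) <= K.
Proof.
move=> /(@slow_term _ r)[B hB]; exists (2 * B) => z hz.
by apply: csum_le => n; apply: hB.
Qed.

(** One family serves two purposes: [tail b c 0] is the value of the series at
    [b], and the later tails are the coefficients of (f(z) - f(b)) / (z - b). Both
    follow from the single recurrence [tail_rec]. *)
Definition tail b c (m : nat) : Cplx R := csum (fun k => c (m + k)%N * b ^+ k).

Definition quot b c (n : nat) : Cplx R := tail b c n.+1.

Lemma tail_term b c r : slow c -> 0 < r -> normc b <= r ->
  exists B, forall m k, normc (c (m + k)%N * b ^+ k) <= (B / r ^+ m) / 2 ^+ k.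
Proof.
move=> sc r0 br; have [B hB] := slow_geometric r sc; exists B => m k.
rewrite modM modX.
have B0 : 0 <= B.
  by have := hB 0%N; rewrite divr1 expr0 mulr1; exact/le_trans/mod_ge0.
rewrite mulrAC ler_pdivlMr ?exprn_gt0//.
apply: (@le_trans _ _ (normc (c (m + k)%N) * r ^+ (m + k)%N)).
  rewrite exprD [r ^+ m * _]mulrC mulrA ler_wpM2r ?exprn_ge0//; first exact: ltW.
  by rewrite ler_wpM2l ?mod_ge0// lerXn2r ?nnegrE ?mod_ge0// ltW.
apply: le_trans (hB _) _; rewrite ler_wpM2l// lef_pV2 ?posrE ?exprn_gt0//.
by rewrite ler_weXn2l ?ler1n// leq_addl.
Qed.

Lemma tail_rec b c m : slow c -> tail b c m = c m + b * tail b c m.+1.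
Proof.
move=> sc; have [B hB] := @tail_term b c (normc b + 1) sc
  ltac:(have := mod_ge0 b; lra) ltac:(lra).
rewrite /tail (csum_recl (hB m)) addn0 expr0 mulr1; congr (_ + _).
rewrite -(csumZ (hB m.+1)); congr csum; apply/funext => k.
by rewrite exprS addnS addSn; ring.
Qed.

Lemma psum_tail c b : psum c b = tail b c 0.
Proof. by []. Qed.

Lemma quot_rec b c n : slow c -> c n.+1 = quot b c n - b * quot b c n.+1.
Proof. by move=> sc; rewrite {1}/quot tail_rec// -/(quot b c n.+1) addrK. Qed.

Lemma quot0 b c : slow c -> psum c b = c 0 + b * quot b c 0.
Proof. by move=> sc; rewrite psum_tail tail_rec. Qed.

Lemma tail_bounded b c r : slow c -> 0 < r ->
  exists B, forall m, normc (tail b c m) * r ^+ m <= B.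
Proof.
move=> sc r0; pose r' := Num.max r (normc b).
have r'0 : 0 < r' by rewrite lt_max r0.
have [B hB] := @tail_term b c r' sc r'0 ltac:(by rewrite le_max lexx orbT).
exists (2 * B) => m.
apply: (@le_trans _ _ (normc (tail b c m) * r' ^+ m)).
  by rewrite ler_wpM2l ?mod_ge0// lerXn2r ?nnegrE ?(ltW r0) ?(ltW r'0)// le_max lexx.
by rewrite -ler_pdivlMr ?exprn_gt0// -mulrA; apply: csum_le.
Qed.

(** The recurrence c_(n+1) = d_n - b d_(n+1) bounds r S by M + |b| S, where S is
    the supremum of |d_n| r^n; S is finite because [c] is of slow growth. *)
Lemma quot_le b c r M : slow c -> normc b < r ->
  (forall n, normc (c n) * r ^+ n <= M) ->
  forall n, normc (quot b c n) * r ^+ n <= M / (r - normc b).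
Proof.
move=> sc br hM.
have r0 : 0 < r := le_lt_trans (mod_ge0 b) br.
pose E := range (fun n => normc (quot b c n) * r ^+ n).
have [B hB] := tail_bounded b sc r0.
have hE : has_sup E.
  split; first by exists (normc (quot b c 0) * r ^+ 0), 0%N.
  exists (B / r) => _ [n _ <-]; rewrite ler_pdivlMr// -mulrA -exprSr.
  exact: hB.
have supE n : normc (quot b c n) * r ^+ n <= sup E.
  by apply: ub_le_sup; [case: hE | exists n].
move=> n; apply: le_trans (supE n) _.
rewrite ler_pdivlMr ?subr_gt0// mulrBr lerBlDr -ler_pdivlMr//.
apply: ge_sup; first by case: hE.
move=> _ [k _ <-]; rewrite ler_pdivlMr// -mulrA -exprSr.
have -> : quot b c k = c k.+1 + b * quot b c k.+1 by rewrite (quot_rec b k sc) subrK.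
have h : normc b * (normc (quot b c k.+1) * r ^+ k.+1) <= sup E * normc b.
  by rewrite mulrC ler_wpM2r ?mod_ge0.
have := hM k.+1; have := modD (c k.+1) (b * quot b c k.+1); rewrite modM => h1 h2.
have : 0 <= r ^+ k.+1 by rewrite exprn_ge0// ltW.
move=> /ler_wpM2r/(_ _ _ h1); rewrite mulrDl; lra.
Qed.

(** On circles of radius at least |b| + 1 division does not increase the
    maximal term; the finitely many smaller radii are absorbed in the constant. *)
Lemma slow_quot b c : slow c -> slow (quot b c).
Proof.
move=> sc; have [D hD] := sc; have [j0 hj0] := pow4_ge (normc b + 1).
have main j n : (j0 <= j)%N ->
    normc (quot b c n) * (4 ^+ j) ^+ n <= 2 ^+ (D * 2 ^ j)%N.
  move=> jj0; have h4 : normc b + 1 <= 4 ^+ j.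
    by apply: le_trans hj0 _; rewrite ler_weXn2l ?ler1n.
  have := @quot_le b c (4 ^+ j) _ sc ltac:(lra) (hD j) n => /le_trans; apply.
  by rewrite ler_pdivrMr ?ler_peMr ?exprn_ge0//; lra.
exists (D * 2 ^ j0)%N => j n; case: (leqP j0 j) => [jj0|jj0].
  apply: le_trans (main j n jj0) _; rewrite ler_weXn2l ?ler1n//.
  by rewrite leq_mul2r leq_pmulr ?expn_gt0 ?orbT.
apply: (@le_trans _ _ (normc (quot b c n) * (4 ^+ j0) ^+ n)).
  rewrite ler_wpM2l ?mod_ge0// lerXn2r ?nnegrE ?exprn_ge0//.
  by rewrite ler_weXn2l ?ler1n// ltnW.
apply: le_trans (main j0 n (leqnn _)) _; rewrite ler_weXn2l ?ler1n//.
by rewrite leq_pmulr ?expn_gt0.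
Qed.

(** Summing the recurrence of the tails by parts gives the identity for partial
    sums up to the term tail_n * z^n, which tends to 0. *)
Lemma psum_quot c b z : slow c ->
  psum c z = psum c b + (z - b) * psum (quot b c) z.
Proof.
move=> sc; have sq := slow_quot b sc.
have [B hB] := slow_term (normc z) sq.
have {hB} hB := hB z (lexx _).
have [B' hB'] := slow_term (normc z) sc.
have {hB'} hB' := hB' z (lexx _).
have [_ h] := csum_geometric hB.
(* the factor 2 makes tail_n * z^n decay like 2^-n *)
have hK1 : 0 < 2 * (normc z + 1) by have := mod_ge0 z; lra.
have [K hK] := tail_bounded b sc hK1.
apply: (@csum_unique _ _ _ (K + normc (z - b) * (2 * B))) => n.
pose s := series (fun n => quot b c n * z ^+ n) n.
have E : series (fun n => c n * z ^+ n) n = psum c b - tail b c n * z ^+ n +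
    (z - b) * s.
  rewrite {}/s.
  elim: n => [|n IH].
    by rewrite /series /= !big_geq// psum_tail expr0; ring.
  rewrite seriesSn IH seriesSn (tail_rec b n sc) /quot exprS.
  move: (series _ n) (tail b c n.+1) (c n) (psum c b) (z ^+ n) => S t x y w; ring.
rewrite {}E.
have regroup (p t w d q v : Cplx R) :
    p - t * w + d * v - (p + d * q) = - (t * w) - d * (q - v) by ring.
rewrite regroup.
apply: le_trans (modB _ _) _; rewrite modN !modM mulrDl lerD//.
  rewrite ler_pdivlMr ?exprn_gt0//; apply: le_trans (hK n).
  rewrite -mulrA ler_wpM2l ?mod_ge0// modX mulrC -exprMn.
  by rewrite lerXn2r ?nnegrE ?mulr_ge0 ?mod_ge0 ?addr_ge0 ?mod_ge0// ler_wpM2l// lerDl.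
by rewrite -mulrA ler_wpM2l ?mod_ge0// h.
Qed.

Lemma psum_continuous c b e : slow c -> 0 < e ->
  exists2 d : R, 0 < d & forall z, normc (z - b) < d -> normc (psum c z - psum c b) < e.
Proof.
move=> sc e0; have [K hK] := psum_bounded (normc b + 1) (slow_quot b sc).
have K0 : 0 <= K by apply: le_trans (hK b _); rewrite ?mod_ge0// lerDl.
exists (Num.min 1 (e / (K + 1))).
  by rewrite lt_min ltr01 divr_gt0//; lra.
move=> z; rewrite lt_min => /andP[h1 h2].
rewrite (psum_quot b z sc) addrAC subrr add0r modM.
have hz : normc (psum (quot b c) z) <= K.
  apply: hK; have := modD b (z - b); rewrite addrC subrK; lra.
rewrite ltr_pdivlMr in h2; last lra.
apply: le_lt_trans h2; rewrite ler_wpM2l ?mod_ge0//; lra.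
Qed.

(** The difference quotient at [b] is the value of [quot b c] at a nearby point,
    so only continuity of that series is needed. *)
Lemma psum_derivable c b : slow c -> derivable (psum c) b 1.
Proof.
move=> sc; apply/cvg_ex; exists (psum (quot b c) b).
apply: cvg_modP => e e0.
have [d d0 hd] := psum_continuous b (slow_quot b sc) e0.
rewrite /dnbhs near_withinE; apply/near_modP; exists d => // h.
rewrite subr0 => hlt h0 /=.
have -> : h *: (1 : Cplx R) = h :> Cplx R by exact: mulr1.
rewrite (psum_quot b (h + b) sc) addrAC subrr add0r addrK.
have -> : h^-1 *: (h * psum (quot b c) (h + b) : Cplx R) = psum (quot b c) (h + b).
  by apply: mulKf.
by apply: hd; rewrite addrK.
Qed.

End PowerSeries.

(** * Orders of vanishing and a Jensen type inequality *)

Section Vanishing.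
Context {R : realType}.
Implicit Types (F G : Cplx R -> Cplx R) (c : nat -> Cplx R) (a b z : Cplx R).

(** A bound in place of a factorisation: it follows from [zero_multiplicity], it
    passes to quotients, and it asks nothing of the regularity of [F]. *)
Definition vanish F a (m : nat) : Prop :=
  exists K : R, \forall z \near a, normc (F z) <= K * normc (z - a) ^+ m.

Lemma vanishP F a m : vanish F a m <-> exists2 K : R, 0 < K &
  exists2 e : R, 0 < e & forall z, normc (z - a) < e ->
    normc (F z) <= K * normc (z - a) ^+ m.
Proof.
split=> [[K /near_modP[e e0 he]]|[K _ [e e0 he]]]; last first.
  by exists K; apply/near_modP; exists e.
exists (Num.max K 1); first by rewrite lt_max ltr01 orbT.
exists e => // z /he /le_trans; apply; rewrite ler_wpM2r ?exprn_ge0 ?mod_ge0//.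
by rewrite le_max lexx.
Qed.

Lemma vanish_root F a m : vanish F a m.+1 -> F a = 0.
Proof.
move=> /vanishP[K K0 [e e0 /(_ a)]]; rewrite subrr mod0 expr0n /= mulr0 => /(_ e0).
by move=> h; apply/eqP; rewrite -mod_eq0 eq_le h mod_ge0.
Qed.

Lemma vanish_le F a m n : (n <= m)%N -> vanish F a m -> vanish F a n.
Proof.
move=> nm /vanishP[K K0 [e e0 h]]; apply/vanishP; exists K => //.
exists (Num.min e 1); first by rewrite lt_min e0 ltr01.
move=> z; rewrite lt_min => /andP[h1 h2]; apply: le_trans (h z h1) _.
by rewrite ler_wpM2l ?(ltW K0)// ler_wiXn2l ?mod_ge0// ltW.
Qed.

Lemma vanish_mul F G a m n : vanish F a m -> vanish G a n ->
  vanish (fun z => F z * G z) a (m + n).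
Proof.
move=> /vanishP[K K0 [e e0 h]] /vanishP[K' K'0 [e' e'0 h']]; apply/vanishP.
exists (K * K'); first exact: mulr_gt0.
exists (Num.min e e'); first by rewrite lt_min e0 e'0.
move=> z; rewrite lt_min => /andP[/h h1 /h' h2].
by rewrite modM exprD mulrACA ler_pM ?mod_ge0.
Qed.

Lemma vanish_subr a b : vanish (fun z => z - b) a (b == a).
Proof.
apply/vanishP; case: eqVneq => [->|ba]; first
  by exists 1 => //; exists 1 => // z _; rewrite mul1r expr1.
exists (1 + normc (a - b)); first by have := mod_ge0 (a - b); lra.
exists 1 => // z hz; rewrite mulr1.
by have := modD (z - a) (a - b); rewrite addrA subrK; lra.
Qed.

Lemma vanish_prod (s : seq (Cplx R)) a :
  vanish (fun z => \prod_(b <- s) (z - b)) a (count_mem a s).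
Proof.
elim: s => [|b s IH].
  by exists 1; apply/near_modP; exists 1 => // z _; rewrite big_nil mod1 mulr1.
have -> : (fun z => \prod_(b <- b :: s) (z - b)) =
    (fun z => (z - b) * \prod_(b <- s) (z - b)).
  by apply/funext => z; rewrite big_cons.
exact: vanish_mul (vanish_subr a b) IH.
Qed.

Lemma vanish_psum0 c a : slow c -> vanish (psum c) a 0.
Proof.
move=> sc; have [K hK] := psum_bounded (normc a + 1) sc.
exists K; apply/near_modP; exists 1 => // z hz; rewrite mulr1; apply: hK.
by have := modD (z - a) a; rewrite subrK; lra.
Qed.

Lemma vanish_psum1 c a : slow c -> psum c a = 0 -> vanish (psum c) a 1.
Proof.
move=> sc ca.
have -> : psum c = (fun z => (z - a) * psum (quot a c) z).
  by apply/funext => z; rewrite (psum_quot a z sc) ca add0r.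
have /vanish_mul := vanish_subr a a; rewrite eqxx.
by move=> /(_ _ _ (vanish_psum0 a (slow_quot a sc))).
Qed.

(** Dividing by z - a lowers the order at [a] by one and keeps it elsewhere. At
    [a] itself the estimate holds on a punctured neighbourhood only, and the
    value is recovered by continuity. *)
Lemma vanish_quot c a b m : slow c -> psum c a = 0 -> vanish (psum c) b m ->
  vanish (psum (quot a c)) b (m - (a == b)).
Proof.
move=> sc ca /vanishP[K K0 [e e0 h]]; have sq := slow_quot a sc.
have E z : psum c z = (z - a) * psum (quot a c) z.
  by rewrite (psum_quot a z sc) ca add0r.
case: (eqVneq a b) => [ab|ab] /=; last first.
  rewrite subn0; apply/vanishP; have d0 : 0 < normc (b - a) by rewrite mod_gt0 subr_eq0 eq_sym.
  exists (2 * K / normc (b - a)); first by rewrite divr_gt0 ?mulr_gt0.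
  exists (Num.min e (normc (b - a) / 2)); first by rewrite lt_min e0 divr_gt0.
  move=> z; rewrite lt_min => /andP[h1 h2].
  rewrite mulrAC ler_pdivlMr// mulrC.
  have := h z h1; rewrite E modM => h3.
  have h4 : normc (b - a) / 2 <= normc (z - a).
    by have := modD (b - z) (z - a); rewrite addrA subrK mod_subC; lra.
  have h5 := @ler_wpM2r R _ (mod_ge0 (psum (quot a c) z)) _ _ h4.
  rewrite -mulrA; lra.
subst b; case: m h => [|m] h; first exact: vanish_psum0.
rewrite subn1 /=; case: m h => [|m] h; first exact: vanish_psum0.
have hz z : z != a -> normc (z - a) < e ->
    normc (psum (quot a c) z) <= K * normc (z - a) ^+ m.+1.
  move=> za /h; rewrite E modM exprS mulrCA ler_pM2l// mod_gt0 subr_eq0//.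
apply/vanishP; exists K => //; exists e => // z ze.
case: (eqVneq z a) => [->|za]; last exact: hz.
rewrite subrr mod0 expr0n /= mulr0; apply/ler_addgt0Pr => d d0; rewrite add0r; apply/ltW.
have [e1 e10 he1] := psum_continuous a sq (divr_gt0 d0 (ltr0Sn R 1)).
(* a point a + t, with t so small that K t and the oscillation are below d *)
pose t := Num.min (Num.min (e / 2) (e1 / 2)) (Num.min 1 (d / (4 * K))).
have K4 : 0 < 4 * K by rewrite mulr_gt0.
have t0 : 0 < t by rewrite !lt_min ltr01 !divr_gt0.
have [t1 t2 t3 t4] : [/\ t <= e / 2, t <= e1 / 2, t <= 1 & t <= d / (4 * K)].
  by split; rewrite !ge_min lexx ?orbT.
have ta : normc (a + (t%:C)%C - a : Cplx R) = t.
  by rewrite addrAC subrr add0r /= expr0n /= addr0 sqrtr_sqr gtr0_norm.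
have nza : (a + (t%:C)%C : Cplx R) != a.
  by rewrite -subr_eq0 -mod_eq0 ta gt_eqF.
have h1 := hz _ nza; rewrite ta in h1.
have h2 := he1 (a + (t%:C)%C); rewrite ta in h2.
have h3 : K * t ^+ m.+1 <= d / 4.
  apply: (@le_trans _ _ (K * t)).
    by rewrite ler_wpM2l ?(ltW K0)// exprS ler_piMr ?(ltW t0)// exprn_ile1// ltW.
  by rewrite ler_pdivlMr ?mulr_gt0// in t4; lra.
have te : t < e by lra.
have te1 : t < e1 by lra.
set p := psum (quot a c) in h1 h2 *.
have := modB (p (a + (t%:C)%C)) (p (a + (t%:C)%C) - p a).
rewrite opprB addrC subrK.
have sum_lt (x y w v : R) : y <= v -> v <= d / 4 -> w < d / 2 -> x <= y + w -> x < d by lra.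
exact: sum_lt (h1 te) h3 (h2 te1).
Qed.

(** Divide by one zero after the other: each division costs 1 / (r - |a|) in norm,
    while the constant coefficients satisfy c_0 = - a d_0. *)
Lemma jensen c (s : seq (Cplx R)) (r M : R) : slow c ->
  (forall a, a \in s -> vanish (psum c) a (count_mem a s)) ->
  (forall a, a \in s -> normc a < r) ->
  (forall n, normc (c n) * r ^+ n <= M) ->
  normc (c 0) * \prod_(a <- s) (r - normc a) <= M * \prod_(a <- s) normc a.
Proof.
elim: s c M => [|a s IH] c M sc hv hr hM.
  by rewrite !big_nil !mulr1; have := hM 0%N; rewrite expr0 mulr1.
have ca : psum c a = 0.
  by have := hv a (mem_head _ _); rewrite /= eqxx; apply: vanish_root.
have har : normc a < r by apply: hr; rewrite mem_head.
have := IH (quot a c) (M / (r - normc a)) (slow_quot a sc).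
have -> : c 0 = - (a * quot a c 0).
  by apply/eqP; rewrite -addr_eq0 -quot0// ca.
rewrite !big_cons modN modM => H.
have {}H := H _ _ (quot_le sc har hM).
have ra0 : r - normc a != 0 by rewrite gt_eqF// subr_gt0.
have -> : normc a * normc (quot a c 0) * ((r - normc a) * \prod_(j <- s) (r - normc j)) =
  (normc a * (r - normc a)) * (normc (quot a c 0) * \prod_(j <- s) (r - normc j)) by ring.
have -> : M * (normc a * \prod_(j <- s) normc j) =
  (normc a * (r - normc a)) * (M / (r - normc a) * \prod_(j <- s) normc j).
  by field.
apply: ler_wpM2l; first by rewrite mulr_ge0 ?mod_ge0// subr_ge0 ltW.
apply: H => b bs; last by apply: hr; rewrite in_cons bs orbT.
have := vanish_quot sc ca (hv b _); rewrite in_cons bs orbT => /(_ isT) /=.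
by rewrite addKn.
Qed.

Lemma jensen_count c (s : seq (Cplx R)) (r r' M : R) : slow c ->
  (forall a, a \in s -> vanish (psum c) a (count_mem a s)) ->
  (forall a, a \in s -> normc a <= r) -> 0 <= r -> r < r' ->
  (forall n, normc (c n) * r' ^+ n <= M) ->
  normc (c 0) * (r' - r) ^+ size s <= M * r ^+ size s.
Proof.
move=> sc hv hr r0 rr' hM.
have M0 : 0 <= M by have := hM 0%N; apply: le_trans; rewrite mulr_ge0 ?mod_ge0.
have pw (x : R) : x ^+ size s = \prod_(a <- s) x.
  by elim: (s) => [|a t IH]; rewrite ?big_nil// big_cons exprS IH.
have := jensen sc hv (fun a h => le_lt_trans (hr a h) rr') hM.
rewrite !pw => /(le_trans _) H; apply: le_trans (H _ _) _.
  rewrite ler_wpM2l ?mod_ge0// big_seq [leRHS]big_seq ler_prod// => a /hr ar.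
  by rewrite subr_ge0 (ltW rr')/= lerB.
rewrite ler_wpM2l// big_seq [leRHS]big_seq ler_prod// => a /hr ar.
by rewrite mod_ge0.
Qed.

End Vanishing.

(** * A zero-free series of order at most 1/2 is constant *)

Section ZeroFree.
Context {R : realType}.
Implicit Types (c : nat -> Cplx R) (a b z : Cplx R).

(** The disc is covered by a square of the plane R * R, which is compact. *)
Lemma psum_min_mod c (r : R) : slow c -> (forall z, psum c z != 0) -> 0 <= r ->
  exists2 d : R, 0 < d & forall z, normc z <= r -> d <= normc (psum c z).
Proof.
move=> sc nz r0.
pose E : set (R * R) := `[- r, r] `*` `[- r, r].
pose f (p : R * R) := normc (psum c (p.1 +i* p.2)%C).
have cE : compact E by apply: compact_setX; exact: segment_compact.
have E0 : E !=set0 by exists (0, 0); split; rewrite /= in_itv/= oppr_le0 r0.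
have fc : continuous f.
  move=> [x y]; apply/cvgrPdist_lt => e e0.
  have [d d0 hd] := psum_continuous (x +i* y)%C sc e0.
  have d2 : 0 < d / 2 by rewrite divr_gt0.
  exists (ball x (d / 2), ball y (d / 2)).
    by split; apply: nbhsx_ballx.
  move=> [x' y'] /= [hx hy]; rewrite /f /= distrC.
  apply: le_lt_trans (mod_dist _ _) _; apply: hd.
  apply: le_lt_trans (mod_ReIm _) _ => /=.
  move: hx hy; rewrite /ball /= distrC => hx; rewrite distrC => hy.
  by rewrite (splitr d) ltrD.
have [p pE hp] := compact_EVT_min E0 cE (continuous_subspaceT fc).
exists (f p); first by rewrite mod_gt0.
move=> z zr; have := hp (complex.Re z, complex.Im z); rewrite /f /=.
have -> : (complex.Re z +i* complex.Im z)%C = z by case: (z).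
apply; rewrite inE; split; rewrite /= in_itv /= -ler_norml;
  by apply: le_trans zr; rewrite ?Re_le_mod ?Im_le_mod.
Qed.

Lemma csum_finite (u : nat -> Cplx R) N : (forall n, (N <= n)%N -> u n = 0) ->
  csum u = \sum_(i < N) u i.
Proof.
move=> hu; apply: lim_near_cst => //.
exists N => // n /= Nn; rewrite /series /= (@big_cat_nat _ _ _ N)//=.
rewrite [X in _ + X]big_nat_cond [X in _ + X]big1 ?addr0 ?big_mkord//.
by move=> i /andP[/andP[/hu]].
Qed.

Lemma psum_poly (p : {poly Cplx R}) z : psum (fun i => p`_i) z = p.[z].
Proof.
rewrite horner_coef; apply: csum_finite => n pn.
by rewrite nth_default ?mul0r.
Qed.

Lemma slow_le c (c' : nat -> Cplx R) : (forall n, normc (c' n) <= normc (c n)) ->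
  slow c -> slow c'.
Proof.
move=> h [D hD]; exists D => j n; apply: le_trans (hD j n).
by rewrite ler_wpM2r ?exprn_ge0.
Qed.

(** The coefficients of prod (1 + b X) are the elementary symmetric functions of
    the b, and the k-th one is a part of the expansion of (sum |b|)^k. *)
Lemma coef_prod_le (s : seq (Cplx R)) k :
  normc (\prod_(b <- s) (1 + b *: 'X : {poly Cplx R}))`_k <= (\sum_(b <- s) normc b) ^+ k.
Proof.
elim: s k => [|b s IH] k.
  by rewrite !big_nil coef1 expr0n; case: (k == 0%N); rewrite ?mulr1n ?mulr0n ?mod1 ?mod0.
rewrite !big_cons mulrDl mul1r coefD -scalerAl coefZ coefXM.
set S := \sum_(_ <- s) _ in IH *; have S0 : 0 <= S by apply: sumr_ge0 => *; apply: mod_ge0.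
case: k => [|k] /=; first by rewrite mulr0 addr0; move: (IH 0%N); rewrite !expr0.
apply: le_trans (modD _ _) _; rewrite modM.
apply: (@le_trans _ _ (S ^+ k.+1 + normc b * S ^+ k)).
  by rewrite lerD ?ler_wpM2l ?mod_ge0.
rewrite exprS -mulrDl addrC exprS ler_wpM2l ?addr_ge0 ?mod_ge0//.
by rewrite lerXn2r ?nnegrE ?addr_ge0 ?mod_ge0// lerDr mod_ge0.
Qed.

(** In the layer 4^j < |a| <= 4^(j+1) there are at most G 2^(j+1) points and each
    contributes less than 4^-j; the layers j >= J form a geometric series. *)
Lemma sum_inv_layers (s : seq (Cplx R)) (G J : nat) :
  (forall a, a \in s -> 4 ^+ J < normc a) ->
  (forall j, (size [seq a <- s | (normc a <= 4 ^+ j)%R] <= G * 2 ^ j)%N) ->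
  \sum_(a <- s) (normc a)^-1 <= 4 * G%:R / 2 ^+ J.
Proof.
move=> hs hG.
have part m : \sum_(a <- s | normc a <= 4 ^+ (J + m)%N) (normc a)^-1 <=
    4 * G%:R / 2 ^+ J - 4 * G%:R / 2 ^+ (J + m)%N.
  elim: m => [|m IH].
    rewrite addn0 subrr big_seq_cond big1// => a /andP[/hs h1 h2].
    by move: (lt_le_trans h1 h2); rewrite ltxx.
  rewrite (bigID (fun a => normc a <= 4 ^+ (J + m)%N)) /=.
  have -> : 4 * G%:R / 2 ^+ (J + m.+1)%N = 2 * G%:R / 2 ^+ (J + m)%N :> R.
    by rewrite addnS exprS; field; rewrite expf_neq0.
  have h1 : \sum_(a <- s | (normc a <= 4 ^+ (J + m.+1)%N) && (normc a <= 4 ^+ (J + m)%N))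
      (normc a)^-1 <= 4 * G%:R / 2 ^+ J - 4 * G%:R / 2 ^+ (J + m)%N.
    rewrite (eq_bigl (fun a => normc a <= 4 ^+ (J + m)%N))// => a.
    rewrite andb_idl// => /le_trans; apply.
    by rewrite ler_weXn2l ?ler1n// leq_add2l.
  have h2 : \sum_(a <- s | (normc a <= 4 ^+ (J + m.+1)%N) && ~~ (normc a <= 4 ^+ (J + m)%N))
      (normc a)^-1 <= 2 * G%:R / 2 ^+ (J + m)%N.
    have k0 : 0 <= (4 ^+ (J + m)%N)^-1 :> R by rewrite invr_ge0 exprn_ge0.
    apply: (@le_trans _ _ (\sum_(a <- s | normc a <= 4 ^+ (J + m.+1)%N) (4 ^+ (J + m)%N)^-1)).
      rewrite [leRHS](bigID (fun a => normc a <= 4 ^+ (J + m)%N)) /=.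
      rewrite -[leLHS]add0r lerD ?sumr_ge0// ler_sum// => a /andP[_].
      rewrite -ltNge => /ltW h; rewrite lef_pV2 ?posrE ?exprn_gt0//.
      by apply: lt_le_trans h; rewrite exprn_gt0.
    rewrite big_const_seq -size_filter iter_addr_0 -[_ *+ size _]mulr_natr.
    have := hG (J + m.+1)%N; rewrite -(ler_nat R) natrM natrX => h.
    apply: (le_trans (ler_wpM2l k0 h)); rewrite addnS exprS.
    have -> : 4 = 2 * 2 :> R by ring.
    rewrite exprMn le_eqVlt; apply/orP; left; apply/eqP; field; rewrite expf_neq0//.
  apply: le_trans (lerD h1 h2) _.
  have -> : 4 * G%:R / 2 ^+ (J + m)%N = 2 * (2 * G%:R / 2 ^+ (J + m)%N) :> R.
    by rewrite !mulrA; congr (_ * _ * _); ring.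
  lra.
have [m hm] : exists m, forall a, a \in s -> normc a <= 4 ^+ (J + m)%N.
  have [m hm] := pow4_ge (\sum_(a <- s) normc a); exists m => a ha.
  apply: (@le_trans _ _ (\sum_(a <- s) normc a)).
    by rewrite (big_rem a)//= lerDl sumr_ge0// => *; apply: mod_ge0.
  by apply: le_trans hm _; rewrite ler_weXn2l ?ler1n// leq_addl.
have := part m.
rewrite big_seq_cond (eq_bigl (fun a => a \in s)); last first.
  by move=> a; rewrite andb_idr// => /hm.
rewrite -big_seq => /le_trans; apply; rewrite gerBl divr_ge0 ?exprn_ge0// mulr_ge0//.
Qed.

Lemma pow2_gt (x : R) : exists n : nat, x < 2 ^+ n.
Proof.
have [j hj] := pow4_ge (2 * `|x|); exists (j + j)%N.
apply: le_lt_trans (ler_norm x) _; rewrite exprD -exprMn.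
have -> : 2 * 2 = 4 :> R by ring.
have [->|x0] := eqVneq `|x| 0; first by rewrite exprn_gt0.
have : 0 < `|x| by rewrite lt_neqAle eq_sym x0 /=.
lra.
Qed.

(** The bound serves all series [c'] dominated by [c] with the same constant
    coefficient: this uniformity over the partial sums of [c] is what
    [zero_free_const] rests on. *)
Lemma root_count_bound c : slow c -> c 0 != 0 -> exists G : nat,
  forall (c' : nat -> Cplx R) (s : seq (Cplx R)) j,
  (forall n, normc (c' n) <= normc (c n)) -> c' 0 = c 0 ->
  (forall a, a \in s -> normc a <= 4 ^+ j) ->
  (forall a, a \in s -> vanish (psum c') a (count_mem a s)) ->
  (size s <= G * 2 ^ j)%N.
Proof.
move=> sc c0; have [D hD] := sc.
pose E := Num.Def.archi_bound (normc (c 0))^-1.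
have hE : (normc (c 0))^-1 <= 2 ^+ E.
  apply: le_trans (ltW (archi_boundP _)) _; first by rewrite invr_ge0 mod_ge0.
  by rewrite -natrX ler_nat ltnW// ltn_expl.
exists (E + D * 2)%N => c' s j c'c c'0 hs hv.
have lt4 : 4 ^+ j < 4 ^+ j.+1 :> R by rewrite exprS ltr_pMl ?exprn_gt0// ltr1n.
have hD' n : normc (c' n) * (4 ^+ j.+1) ^+ n <= 2 ^+ (D * 2 ^ j.+1)%N.
  by apply: le_trans (hD j.+1 n); rewrite ler_wpM2r ?exprn_ge0.
have := jensen_count (slow_le c'c sc) hv hs (exprn_ge0 j (ler0n R 4)) lt4 hD'.
rewrite c'0 exprS.
have -> : 4 * 4 ^+ j - 4 ^+ j = 3 * 4 ^+ j :> R by ring.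
rewrite exprMn mulrA ler_pM2r ?exprn_gt0// => h.
have : 2 ^+ size s <= 2 ^+ (E + D * 2 ^ j.+1)%N :> R.
  apply: (@le_trans _ _ (3 ^+ size s)); first by rewrite lerXn2r ?nnegrE// ler_nat.
  rewrite mulrC -ler_pdivlMr ?mod_gt0// in h; apply: le_trans h _.
  by rewrite exprD [leRHS]mulrC ler_wpM2l ?exprn_ge0.
rewrite ler_eXn2l ?ltr1n// => /leq_trans; apply.
rewrite mulnDl expnS mulnA leq_add2r leq_pmulr// expn_gt0//.
Qed.

(** A zero-free series stays away from 0 on the disc of radius 4^J, hence so does
    a late partial sum p. The inverses of the roots of p then have a small sum,
    and by [coef_prod_le] its nonconstant coefficients are small as well. *)
Lemma zero_free_const c : slow c -> (forall z, psum c z != 0) ->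
  forall k, (0 < k)%N -> c k = 0.
Proof.
move=> sc nz k k0.
have c0 : c 0 != 0.
  have := nz 0; rewrite (quot0 0 sc) mul0r addr0//.
have [G hG] := root_count_bound sc c0.
suff main J : normc (c k) <= normc (c 0) * (4 * G%:R / 2 ^+ J) ^+ k.
  apply/eqP; rewrite -mod_eq0 eq_le mod_ge0 andbT.
  apply/ler_addgt0Pr => e e0; rewrite add0r; apply/ltW.
  pose C := normc (c 0) * (4 * G%:R) ^+ k.
  have C0 : 0 <= C by rewrite mulr_ge0 ?mod_ge0 ?exprn_ge0// mulr_ge0.
  have [J hJ] := pow2_gt (C / e).
  apply: le_lt_trans (main J) _.
  rewrite exprMn mulrA -/C exprVn -exprM ltr_pdivrMr ?exprn_gt0//.
  rewrite ltr_pdivrMr// mulrC in hJ; apply: lt_le_trans hJ _.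
  by rewrite ler_pM2l// ler_weXn2l ?ler1n// leq_pmulr.
have [d d0 hd] := psum_min_mod sc nz (exprn_ge0 J (ler0n R 4)).
have [B hB] := slow_term (4 ^+ J) sc.
have [N1 hN1] := pow2_gt (2 * B / d).
pose N := maxn N1 k.+1.
pose p : {poly Cplx R} := \poly_(i < N) c i.
have pc i : p`_i = if (i < N)%N then c i else 0 by rewrite coef_poly.
have sp : slow (fun i => p`_i).
  by apply: slow_le sc => i; rewrite pc; case: ifP => // _; rewrite mod0 mod_ge0.
have p00 : p`_0 = c 0 by rewrite pc leq_max orbT.
have pk : p`_k = c k by rewrite pc leq_max ltnSn orbT.
have far a : p.[a] = 0 -> 4 ^+ J < normc a.
  move=> pa; rewrite ltNge; apply/negP => aJ.
  have [_ h] := csum_geometric (hB a aJ).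
  have := hd a aJ; rewrite leNgt => /negP; apply.
  have <- : csum (fun n => c n * a ^+ n) - series (fun n => c n * a ^+ n) N = psum c a.
    have -> : series (fun n => c n * a ^+ n) N = 0.
      rewrite -pa /series /= big_mkord horner_poly//.
    by rewrite subr0.
  apply: le_lt_trans (h N) _.
  rewrite ltr_pdivrMr ?exprn_gt0// [ltRHS]mulrC.
  rewrite ltr_pdivrMr// in hN1; apply: lt_le_trans hN1 _.
  by rewrite ler_pM2r// ler_weXn2l ?ler1n// leq_maxl.
have [s hs] := closed_field_poly_normal (p : {poly Cplx R}).
set l := lead_coef p in hs.
have ps z : p.[z] = l * \prod_(a <- s) (z - a).
  rewrite hs hornerZ horner_prod; congr (_ * _); apply: eq_bigr => a _.
  by rewrite hornerXsubC.
have sfar a : a \in s -> 4 ^+ J < normc a.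
  by move=> as_; apply: far; rewrite ps (big_rem a)//= subrr mul0r mulr0.
have sn0 a : a \in s -> a != 0.
  by move=> /sfar h; rewrite -mod_gt0; apply: lt_trans h; rewrite exprn_gt0.
have S1 : \sum_(a <- s) (normc a)^-1 <= 4 * G%:R / 2 ^+ J.
  apply: sum_inv_layers => // j.
  apply: (hG (fun i => p`_i)) => // [i|a|a].
  - by rewrite pc; case: ifP => // _; rewrite mod0 mod_ge0.
  - by rewrite mem_filter => /andP[].
  move=> _; apply: (@vanish_le _ _ _ (count_mem a s)).
    by rewrite count_filter; apply: sub_count => b /= /andP[].
  rewrite (_ : psum _ = (fun z => l * \prod_(a <- s) (z - a))); last first.
    by apply/funext => z; rewrite psum_poly ps.
  rewrite -[count_mem a s]add0n; apply: vanish_mul (vanish_prod s a).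
  by exists (normc l); apply/near_modP; exists 1 => // z _; rewrite mulr1.
have pE : p = c 0 *: \prod_(b <- [seq - a^-1 | a <- s]) (1 + b *: 'X).
  rewrite -p00 -horner_coef0 ps [LHS]hs -scalerA; congr (_ *: _).
  rewrite big_map -scaler_prod; apply: eq_big_seq => a /sn0 a0.
  by rewrite sub0r scalerDr scalerA mulrNN mulfV// scale1r -alg_polyC scaleNr addrC.
rewrite -pk pE coefZ modM ler_wpM2l ?mod_ge0//.
apply: le_trans (coef_prod_le _ _) _; rewrite big_map.
rewrite lerXn2r ?nnegrE ?sumr_ge0 => //; rewrite ?divr_ge0 ?exprn_ge0 ?mulr_ge0//.
  by move=> a _; apply: mod_ge0.
by under eq_bigr do rewrite modN modV.
Qed.

End ZeroFree.

(** * Removing zeros in order of their modulus *)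

Section Deflation.
Context {R : realType}.
Implicit Types (c : nat -> Cplx R) (a b z : Cplx R).

(** The class that is stable under removal of a zero. Zeros at the origin are
    meant to be divided out beforehand, whence the condition on [c 0]. *)
Definition transcendental c : Prop :=
  [/\ slow c, c 0 != 0 & forall N, exists2 n, (N <= n)%N & c n != 0].

Definition is_min_root c a : Prop :=
  psum c a = 0 /\ forall b, psum c b = 0 -> normc a <= normc b.

Lemma psum0 c : slow c -> psum c 0 = c 0.
Proof. by move=> sc; rewrite (quot0 0 sc) mul0r addr0. Qed.

(** Without a zero of least modulus there would be arbitrarily many distinct
    zeros of decreasing modulus in one disc, against [root_count_bound]. *)
Lemma min_root_exists c : transcendental c -> exists a, is_min_root c a.
Proof.
move=> [sc c0 cinf].
have [z0 z0P] : exists z, psum c z = 0.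
  apply: contrapT => /forallNP nz.
  have [n n1] := cinf 1%N; apply/negP; rewrite negbK; apply/eqP.
  by apply: zero_free_const => // z; apply/eqP/nz.
apply: contrapT => /forallNP nomin.
have smaller a : psum c a = 0 -> exists2 b, psum c b = 0 & normc b < normc a.
  move=> ca; apply: contrapT => h; apply: (nomin a); split=> // b cb.
  by rewrite leNgt; apply/negP => ba; apply: h; exists b.
have chain n : exists (a : Cplx R) s,
    [/\ size s = n, uniq s, psum c a = 0 /\ normc a <= normc z0 &
    forall b, b \in s -> [/\ psum c b = 0, normc b <= normc z0 & normc a < normc b]].
  elim: n => [|n [a [s [ss us [ca az] hs]]]]; first by exists z0, [::].
  have [b cb ba] := smaller a ca.
  exists b, (a :: s); split => /=; first by rewrite ss.
  - by rewrite us andbT; apply/negP => /hs[_ _]; rewrite ltxx.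
  - by split=> //; apply: le_trans (ltW ba) az.
  move=> x; rewrite in_cons => /predU1P[->//|/hs[cx xz ax]].
  by split=> //; apply: lt_trans ax.
have [G hG] := root_count_bound sc c0; have [j hj] := pow4_ge (normc z0).
have [a [s [ss us _ hs]]] := chain (G * 2 ^ j).+1.
have := hG c s j (fun=> lexx _) erefl; rewrite ss ltnn => H.
suff: false by [].
apply: H => b /[dup] bs /hs[cb bz _]; first exact: le_trans bz hj.
by rewrite count_uniq_mem// bs; apply: vanish_psum1.
Qed.

(** If the quotient were a polynomial, so would be the series, by [quot_rec]. *)
Lemma transcendental_quot c a : transcendental c -> psum c a = 0 ->
  transcendental (quot a c).
Proof.
move=> [sc c0 cinf] ca; split; first exact: slow_quot.
  apply: contraNneq c0 => q0.
  by have := quot0 a sc; rewrite ca q0 mulr0 addr0 => <-.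
move=> N; apply: contrapT => h.
have q0 n : (N <= n)%N -> quot a c n = 0.
  by move=> Nn; apply/eqP; apply: contrapT => /negP qn; apply: h; exists n.
have [[|n] // Nn] := cinf N.+1.
by rewrite (quot_rec a n sc) !q0 ?mulr0 ?subrr ?eqxx// ltnW.
Qed.

Definition min_root c : Cplx R := get (is_min_root c).

Lemma min_rootP c : transcendental c -> is_min_root c (min_root c).
Proof. by move=> /min_root_exists[a ha]; apply: (@getPex _ (is_min_root c)); exists a. Qed.

Fixpoint deflate c n : nat -> Cplx R :=
  if n is n'.+1 then quot (min_root (deflate c n')) (deflate c n') else c.

Definition sorted_root c n : Cplx R := min_root (deflate c n).

Definition first_roots c n : seq (Cplx R) := [seq sorted_root c i | i <- iota 0 n].

Section SortedRoots.
Variables (c : nat -> Cplx R) (tc : transcendental c).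

Lemma deflate_trans n : transcendental (deflate c n).
Proof.
elim: n => [//|n IH] /=; apply: transcendental_quot => //.
by case: (min_rootP IH).
Qed.

Lemma sorted_rootP n : is_min_root (deflate c n) (sorted_root c n).
Proof. exact/min_rootP/deflate_trans. Qed.

Lemma psum_deflateS n z :
  psum (deflate c n) z = (z - sorted_root c n) * psum (deflate c n.+1) z.
Proof.
have [sc _ _] := deflate_trans n.
by have [h _] := sorted_rootP n; rewrite (psum_quot (sorted_root c n) z sc) h add0r.
Qed.

Lemma psum_deflate n z :
  psum c z = \prod_(b <- first_roots c n) (z - b) * psum (deflate c n) z.
Proof.
elim: n => [|n IH]; first by rewrite big_nil mul1r.
rewrite IH psum_deflateS /first_roots -addn1 iotaD map_cat big_cat /= big_seq1 mulrA.
by rewrite add0n addn1.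
Qed.

Lemma sorted_root_mono n : normc (sorted_root c n) <= normc (sorted_root c n.+1).
Proof.
have [_ h] := sorted_rootP n; apply: h; rewrite psum_deflateS.
by have [-> _] := sorted_rootP n.+1; rewrite mulr0.
Qed.

Lemma sorted_root_le i j : (i <= j)%N -> normc (sorted_root c i) <= normc (sorted_root c j).
Proof.
move=> /subnKC <-; elim: (j - i)%N => [|k IH]; first by rewrite addn0.
by rewrite addnS; apply: le_trans IH (sorted_root_mono _).
Qed.

Lemma sorted_root_is_root n : psum c (sorted_root c n) = 0.
Proof.
by rewrite (psum_deflate n); have [-> _] := sorted_rootP n; rewrite mulr0.
Qed.

Lemma sorted_root_neq0 n : sorted_root c n != 0.
Proof.
have [sc c0 _] := tc; apply: contraNneq c0 => h.
by have := sorted_root_is_root n; rewrite h psum0// => ->.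
Qed.

(** In a fixed disc [root_count_bound] limits the number of removed zeros. *)
Lemma sorted_root_unbounded (r : R) : exists n, r < normc (sorted_root c n).
Proof.
apply: contrapT => /forallNP h.
have [sc c0 _] := tc.
have [G hG] := root_count_bound sc c0; have [j hj] := pow4_ge r.
have := hG c (first_roots c (G * 2 ^ j).+1) j (fun=> lexx _) erefl.
rewrite size_map size_iota ltnn => H; suff: false by [].
apply: H => [b /mapP[i _ ->]|a _].
  by apply: le_trans hj; rewrite leNgt; apply/negP/h.
set s := first_roots _ _.
have -> : psum c = fun z => \prod_(b <- s) (z - b) * psum (deflate c (G * 2 ^ j).+1) z.
  by apply/funext => z; rewrite (psum_deflate (G * 2 ^ j).+1).
rewrite -[count_mem a s]addn0; apply: vanish_mul (vanish_prod s a) _.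
by apply: vanish_psum0; case: (deflate_trans (G * 2 ^ j).+1).
Qed.

Lemma sorted_root_eventually a : exists2 N, psum (deflate c N) a != 0 &
  forall n, (N <= n)%N -> sorted_root c n != a.
Proof.
have [N hN] := sorted_root_unbounded (normc a); exists N.
  apply: contraTneq hN => h; rewrite -leNgt.
  by have [_] := sorted_rootP N; apply.
move=> n /sorted_root_le h; apply: contraTneq hN => <-; rewrite -leNgt//.
Qed.

End SortedRoots.
End Deflation.

(** * The arranged sequence of zeros *)

Lemma card_seq_II (t : seq nat) : uniq t -> ([set n | n \in t] #= `I_(size t))%card.
Proof.
move=> ut; have -> : [set n | n \in t] = [set nth 0%N t i | i in `I_(size t)].
  apply/seteqP; split=> [n /= /(nthP 0%N)[i it <-]|_ [i it <-]]; first by exists i.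
  exact: mem_nth.
apply: inj_card_eq => i j; rewrite !inE /= => it jt /eqP; rewrite nth_uniq// => /eqP//.
Qed.

Section Arranged.
Context {R : realType}.
Implicit Types (c : nat -> Cplx R) (a b z : Cplx R).

Lemma derivable_poly (p : {poly Cplx R}) z : derivable (horner p) z 1.
Proof.
elim/poly_ind: p => [|p b IH].
  have -> : horner (0 : {poly Cplx R}) = cst 0 by apply/funext => x; rewrite horner0.
  exact: derivable_cst.
have -> : horner (p * 'X + b%:P) = (fun x : Cplx R => p.[x] * x : Cplx R) + cst b.
  by apply/funext => x; rewrite !hornerE.
apply: derivableD; last exact: derivable_cst.
have did : derivable (fun x : Cplx R => x) z 1 by exact: derivable_id.
exact: (@derivableM R[i] _ (horner p) (fun x : Cplx R => x) z 1 IH did).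
Qed.

(** Once N zeros are removed, N large, the remaining series does not vanish at
    [a]. The multiplicity of [a] is thus the number of its occurrences among the
    N removed zeros, and the other factors make up the holomorphic cofactor. *)
Lemma sorted_root_arranged c m : transcendental c ->
  nonzero_roots_arranged (fun z => z ^+ m * psum c z) (fun n => sorted_root c n.-1).
Proof.
move=> tc; split=> [n _|a a0|n n0].
- by rewrite mod_gt0 sorted_root_neq0.
- have [N hN hge] := sorted_root_eventually tc a.
  pose s := first_roots c N; exists (count_mem a s).
    pose p : {poly Cplx R} := 'X^m * \prod_(b <- s | b != a) ('X - b%:P).
    have pE z : p.[z] = z ^+ m * \prod_(b <- s | b != a) (z - b).
      rewrite hornerM hornerXn horner_prod; congr (_ * _).
      by apply: eq_bigr => b _; rewrite hornerXsubC.
    have [sN _ _] := deflate_trans tc N.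
    exists (fun z => p.[z] * psum (deflate c N) z); split.
    + rewrite mulf_neq0// pE mulf_neq0 ?expf_neq0//.
      by rewrite prodf_seq_neq0; apply/allP => b _; apply/implyP; rewrite subr_eq0 eq_sym.
    + apply/near_modP; exists 1 => // z _.
      exact: (@derivableM R[i] _ (horner p) (psum (deflate c N)) z 1
        (@derivable_poly p z) (@psum_derivable R _ z sN)).
    apply/near_modP; exists 1 => // z _.
    rewrite pE (psum_deflate tc N) (bigID (fun b => b == a)) /= -/s.
    have -> : \prod_(b <- s | b == a) (z - b) = (z - a) ^+ count_mem a s.
      rewrite (eq_bigr (fun=> z - a)); last by move=> b /eqP->.
      by rewrite big_const_seq iter_mulr_1.
    have regroup (x y v w : Cplx R) : x * (y * v * w) = y * (x * v * w) by ring.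
    exact: regroup.
  have -> : [set n | (0 < n)%N /\ sorted_root c n.-1 = a] =
      [set n | n \in [seq i <- iota 1 N | sorted_root c i.-1 == a]].
    apply/seteqP; split=> n /=; rewrite mem_filter mem_iota add1n ltnS.
      move=> [n0 na]; rewrite na eqxx n0 /=.
      case: n n0 na => // n _ /= na; rewrite ltnNge; apply/negP => /hge.
      by rewrite na eqxx.
    by move=> /andP[/eqP-> /andP[]].
  have -> : count_mem a s = size [seq i <- iota 1 N | sorted_root c i.-1 == a].
    by rewrite size_filter /s /first_roots count_map -[1%N]addn0 iotaDl count_map.
  by apply: card_seq_II; rewrite filter_uniq// iota_uniq.
case: n n0 => // n _; exact: sorted_root_mono.
Qed.

Lemma infinite_roots c m : transcendental c ->
  infinite_set [set z : Cplx R | z != 0 /\ z ^+ m * psum c z = 0].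
Proof.
move=> tc /finite_seqP[s hs].
have [N hN] := sorted_root_unbounded tc (\sum_(a <- s) normc a).
have : [set z : Cplx R | z != 0 /\ z ^+ m * psum c z = 0] (sorted_root c N).
  by split; [exact: sorted_root_neq0 | rewrite sorted_root_is_root// mulr0].
rewrite hs /= => Ns; move: hN; rewrite (big_rem (sorted_root c N))//= ltNge lerDl.
by rewrite sumr_ge0// => *; apply: mod_ge0.
Qed.

End Arranged.

(** * Gaussian coefficients and the growth of the zeros *)

Section Growth.
Context {R : realType}.
Implicit Types (c : nat -> Cplx R) (a b z : Cplx R) (M g k : R).

Definition gaussian c M g := forall n, normc (c n) <= M * expR (- (g * n%:R ^+ 2)).

(** Complete the square: x n - g n^2 = x^2 / (4 g) - g (x / (2 g) - n)^2. *)
Lemma gaussian_le c M g (x : R) n : 0 < g -> gaussian c M g ->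
  normc (c n) * expR x ^+ n <= M * expR (x ^+ 2 / (4 * g)).
Proof.
move=> g0 hc.
have M0 : 0 <= M.
  by have := hc 0%N; rewrite expr0n mulr0 oppr0 expR0 mulr1; apply/le_trans/mod_ge0.
apply: le_trans (ler_wpM2r _ (hc n)) _; first by rewrite exprn_ge0 ?expR_ge0.
rewrite -mulrA ler_wpM2l// -expRM_natr -expRD ler_expR -subr_ge0.
have -> : x ^+ 2 / (4 * g) - (- (g * n%:R ^+ 2) + x * n%:R) =
  (x / (2 * g) - n%:R) ^+ 2 * g by field; rewrite gt_eqF.
by rewrite mulr_ge0 ?sqr_ge0// ltW.
Qed.

Lemma sqr_le_exp2 j : (j ^ 2 <= 2 * 2 ^ j)%N.
Proof.
case: j => [|[|[|j]]]//; elim: j => // j IH.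
rewrite [(2 ^ j.+4)%N]expnS; nia.
Qed.

(** At x = j log 4 the Gaussian bound grows like exp(C j^2), and j^2 <= 2 * 2^j. *)
Lemma gaussian_slow c M g : 0 < g -> gaussian c M g -> slow c.
Proof.
move=> g0 hc.
have [D1 hD1] := pow2_gt M.
have l4 : 0 < ln 4 :> R by rewrite ln_gt0// ltr1n.
pose K := expR (ln 4 ^+ 2 / (4 * g)).
have [D2 hD2] := pow2_gt K.
exists (D1 + 2 * D2)%N => j n.
have -> : 4 ^+ j = expR (j%:R * ln 4) :> R.
  by rewrite mulrC expRM_natr lnK// posrE.
apply: le_trans (gaussian_le _ _ g0 hc) _.
have -> : (j%:R * ln 4) ^+ 2 / (4 * g) = (ln 4 ^+ 2 / (4 * g)) * (j ^ 2)%:R.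
  by rewrite natrX; ring.
rewrite expRM_natr -/K.
apply: (@le_trans _ _ (2 ^+ D1 * 2 ^+ (D2 * j ^ 2)%N)).
  rewrite ler_pM ?exprn_ge0 ?expR_ge0//; last first.
  - by rewrite exprM lerXn2r ?nnegrE ?exprn_ge0 ?expR_ge0// ltW.
  - exact: ltW.
  by have := hc 0%N; rewrite expr0n mulr0 oppr0 expR0 mulr1; apply/le_trans/mod_ge0.
rewrite -exprD ler_weXn2l ?ler1n//.
have := sqr_le_exp2 j; have : (0 < 2 ^ j)%N by rewrite expn_gt0.
nia.
Qed.

Lemma expR_sub1 (x : R) : 1 <= x -> expR (x - 1) <= expR x - 1.
Proof.
move=> x1.
have h : 1 <= expR (x - 1) by have := expR_ge1Dx (x - 1); lra.
have -> : expR x = expR 1 * expR (x - 1) by rewrite -expRD; congr expR; ring.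
have : 2 <= expR 1 :> R by have := expR_ge1Dx (1 : R); rewrite -natr1; lra.
nra.
Qed.

(** With radii e^(kn) and e^(2kn) the inequality of [jensen_count] reads
    |c_0| (e^(kn) - 1)^n <= M e^(k^2 n^2 / g). As e^(kn) - 1 >= e^(kn-1), it
    implies |c_0| e^(n (d n - 1)) <= M with d = k - k^2 / g > 0. *)
Lemma gaussian_zeros c M g k : gaussian c M g -> c 0 != 0 -> 0 < k < g ->
  exists N, forall (s : seq (Cplx R)), (N <= size s)%N ->
    (forall a, a \in s -> vanish (psum c) a (count_mem a s)) ->
    ~ (forall a, a \in s -> normc a <= expR (k * (size s)%:R)).
Proof.
move=> hc c0 /andP[k0 kg]; have g0 : 0 < g := lt_trans k0 kg.
pose d := k - k ^+ 2 / g.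
have d0 : 0 < d.
  by rewrite /d subr_gt0 ltr_pdivrMr// expr2 ltr_pM2l.
have nc0 : 0 < normc (c 0) by rewrite mod_gt0.
(* so that d n >= 2, k n >= 1 and M < n |c_0| *)
pose N := Num.Def.archi_bound (2 / d + 1 / k + `|M / normc (c 0)|).
exists N => s; set n := size s => Nn hv hs.
have nN : 2 / d + 1 / k + `|M / normc (c 0)| < n%:R.
  apply: lt_le_trans (archi_boundP _) _; last by rewrite ler_nat.
  by rewrite !addr_ge0// divr_ge0// ltW.
have [n1 n2 n3] : [/\ 2 / d <= n%:R, 1 / k <= n%:R & M / normc (c 0) < n%:R].
  have h1 : 0 <= 2 / d by rewrite divr_ge0// ltW.
  have h2 : 0 <= 1 / k by rewrite divr_ge0// ltW.
  have := ler_norm (M / normc (c 0)); have := normr_ge0 (M / normc (c 0)).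
  by split; lra.
rewrite ler_pdivrMr// in n1; rewrite ler_pdivrMr// in n2; rewrite ltr_pdivrMr// in n3.
have lt1 : expR (k * n%:R) < expR (2 * k * n%:R).
  by rewrite ltr_expR; lra.
have sc := gaussian_slow g0 hc.
have := jensen_count sc hv hs (expR_ge0 _) lt1 (fun i => gaussian_le _ i g0 hc).
rewrite -/n leNgt => /negP; apply.
have -> : expR (2 * k * n%:R) - expR (k * n%:R) =
    expR (k * n%:R) * (expR (k * n%:R) - 1).
  by rewrite mulrBr mulr1 -expRD; congr (expR _ - _); ring.
rewrite [(expR _ * _) ^+ n]exprMn [ltRHS]mulrCA [ltRHS]mulrC ltr_pM2r ?exprn_gt0 ?expR_gt0//.
apply: (@lt_le_trans _ _ (normc (c 0) * expR (k * n%:R - 1) ^+ n)); last first.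
  rewrite ler_pM2l// lerXn2r ?nnegrE ?expR_ge0 ?subr_ge0//.
    by have := expR_ge1Dx (k * n%:R); lra.
  by apply: expR_sub1; lra.
have -> : (2 * k * n%:R) ^+ 2 / (4 * g) = (k ^+ 2 / g) * n%:R * n%:R.
  by field; rewrite gt_eqF.
rewrite -expRM_natr.
have -> : (k * n%:R - 1) * n%:R = (d * n%:R - 1) * n%:R + k ^+ 2 / g * n%:R * n%:R.
  by rewrite /d; ring.
rewrite expRD mulrA ltr_pM2r ?expR_gt0//.
apply: lt_le_trans n3 _; rewrite mulrC ler_pM2l//.
apply: (@le_trans _ _ (expR n%:R)).
  by have := expR_ge1Dx (n%:R : R); lra.
rewrite ler_expR ler_peMl//; lra.
Qed.

End Growth.

(** * Arbitrary arrangements, and the reduction of the theorem *)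

Section Final.
Context {R : realType}.
Implicit Types (c : nat -> Cplx R) (a b z : Cplx R).

Lemma card_seq_le (t : seq nat) (A : set nat) m : uniq t ->
  (forall n, n \in t -> A n) -> (A #= `I_m)%card -> (size t <= m)%N.
Proof.
move=> ut tA Am; rewrite -card_le_II.
rewrite -(card_le_eqr Am) -(card_le_eql (card_seq_II ut)).
exact: subset_card_le.
Qed.

Lemma zero_multiplicity_vanish (F : Cplx R -> Cplx R) a m :
  zero_multiplicity F a m -> vanish F a m.
Proof.
move=> [g [_ /near_modP[e e0 dg] /near_modP[e' e'0 hF]]].
have ga : derivable g a 1 by apply: dg; rewrite subrr mod0.
have /differentiable_continuous cg : differentiable g a by apply/derivable1_diffP.
have /near_modP[e1 e10 he1] : \forall z \near a, normc (g z - g a) < 1.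
  by apply: (cg [set w | normc (w - g a) < 1]); apply/near_modP; exists 1.
exists (normc (g a) + 1); apply/near_modP; exists (Num.min e' e1).
  by rewrite lt_min e'0.
move=> z; rewrite lt_min => /andP[/hF -> /he1 h].
rewrite modM modX mulrC ler_wpM2r ?exprn_ge0 ?mod_ge0//.
by have := modD (g z - g a) (g a); rewrite subrK; lra.
Qed.

(** An arrangement lists a point as often as its multiplicity, so an initial
    segment lists it at most that often. *)
Lemma arranged_vanish (F : Cplx R -> Cplx R) rho n a :
  nonzero_roots_arranged F rho -> a \in [seq rho i | i <- iota 1 n] ->
  a != 0 /\ vanish F a (count_mem a [seq rho i | i <- iota 1 n]).
Proof.
move=> [pos mult _] ha; have [i ii aE] := mapP ha; have {ii} i0 : (0 < i)%N.
  by move: ii; rewrite mem_iota => /andP[].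
have a0 : a != 0 by rewrite -mod_gt0 aE pos.
split=> //; have [m mult_a card_m] := mult a a0.
apply: (vanish_le _ (zero_multiplicity_vanish mult_a)).
rewrite count_map -size_filter; apply: card_seq_le card_m; first by rewrite filter_uniq// iota_uniq.
by move=> k; rewrite mem_filter mem_iota => /andP[/eqP ? /andP[? _]].
Qed.

Lemma vanish_expr_mul (F : Cplx R -> Cplx R) a m k : a != 0 ->
  vanish (fun z => z ^+ m * F z) a k -> vanish F a k.
Proof.
rewrite -mod_gt0 => a0 /vanishP[K K0 [e e0 h]].
have d0 : 0 < normc a / 2 by rewrite divr_gt0.
exists (K / (normc a / 2) ^+ m); apply/near_modP; exists (Num.min e (normc a / 2)).
  by rewrite lt_min e0.
move=> z; rewrite lt_min => /andP[/h h1 h2].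
rewrite mulrAC ler_pdivlMr ?exprn_gt0//; apply: le_trans h1.
rewrite modM modX mulrC ler_wpM2r ?mod_ge0// lerXn2r ?nnegrE ?mod_ge0 ?(ltW d0)//.
have := modD (a - z) z; rewrite subrK mod_subC; lra.
Qed.

Lemma psum_shift c m z : slow c -> (forall n, (n < m)%N -> c n = 0) ->
  psum c z = z ^+ m * psum (fun n => c (m + n)%N) z.
Proof.
move=> sc h; change (psum c z = z ^+ m * tail z c m).
elim: m h => [|m IH] h; first by rewrite mul1r.
rewrite IH; last by move=> n nm; apply: h; rewrite ltnS ltnW.
by rewrite (tail_rec z m sc) (h m)// add0r mulrA -exprSr.
Qed.

Lemma mod_cpow (logq : Cplx R) (b : R) :
  normc (cpow logq b) = expR (b * complex.Re logq).
Proof.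
rewrite /cpow /cexp modM.
have mod_expi (t : R) : normc (cos t +i* sin t)%C = 1.
  by rewrite /= cos2Dsin2 sqrtr1.
rewrite mod_expi mulr1 /= expr0n /= addr0 sqrtr_sqr ger0_norm ?expR_ge0//.
by case: logq => x y /=; rewrite mul0r subr0.
Qed.

End Final.

Theorem corollary3 (R : realType) (alpha : R) (q logq : Cplx R)
    (fc : nat -> Cplx R)
    (halpha : 0 < alpha)
    (hq : 0 < Normc.normc q < 1)
    (hlogq : cexp logq = q)
    (hfc_bounded :
      (ereal_sup (range (fun n : nat => (Normc.normc (fc n))%:E)) < +oo)%E)
    (hfc_infinite :
      ereal_sup [set (n%:R : R)%:E | n in [set n : nat | fc n != 0]] = +oo%E) :
  let f := qseries alpha logq fc in
  infinite_set [set z : Cplx R | z != 0 /\ f z = 0] /\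
  (exists rho : nat -> Cplx R, nonzero_roots_arranged f rho) /\
  (forall rho : nat -> Cplx R, nonzero_roots_arranged f rho ->
   forall C eta : R,
     - (1 / (4 * alpha * ln (Normc.normc q))) < C ->
     0 < eta < 1 ->
     exists2 N : nat, (0 < N)%N &
       forall n : nat, (N <= n)%N ->
         expR (growth_rate eta C * n%:R) <= Normc.normc (rho n)).
Proof.
have [q0 q1] := andP hq.
pose L := - ln (normc q).
have L0 : 0 < L by rewrite oppr_gt0 ln_lt0// q0.
have ReL : complex.Re logq = - L.
  have : normc (cpow logq 1) = normc q by rewrite /cpow mul1r hlogq.
  by rewrite mod_cpow mul1r /L opprK => <-; rewrite expRK.
pose g := alpha * L; have g0 : 0 < g by apply: mulr_gt0.
pose c n : Cplx R := fc n * cpow logq (alpha * n%:R ^+ 2).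
have [M hM] : exists M, forall n, normc (fc n) <= M.
  have : (ereal_sup (range (fun n : nat => (normc (fc n))%:E)) >= (normc (fc 0))%:E)%E.
    by apply: ereal_sup_ubound; exists 0%N.
  move: hfc_bounded; case E: (ereal_sup _) => [M| |]// _ _.
  exists M => n; rewrite -lee_fin -E; apply: ereal_sup_ubound; by exists n.
have hc : gaussian c M g.
  move=> n; rewrite modM mod_cpow ReL.
  have -> : alpha * n%:R ^+ 2 * - L = - (g * n%:R ^+ 2) by rewrite /g; ring.
  by rewrite ler_wpM2r ?expR_ge0.
have sc := gaussian_slow g0 hc.
have cpow0 b : cpow logq b != 0 by rewrite -mod_gt0 mod_cpow expR_gt0.
have cinf N : exists2 n, (N <= n)%N & c n != 0.
  apply: contrapT => h.
  have : (ereal_sup [set (n%:R : R)%:E | n in [set n : nat | (fc n != 0)%R]] <= (N%:R)%:E)%E.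
    apply: ge_ereal_sup => _ [n /= fn <-]; rewrite lee_fin ler_nat leqNgt.
    apply/negP => Nn; apply: h; exists n; first exact: ltnW.
    by rewrite mulf_neq0.
  by rewrite hfc_infinite.
have exc : exists n, c n != 0 by have [n _ ?] := cinf 0%N; exists n.
pose m := ex_minn exc.
have [cm mmin] : c m != 0 /\ forall n, c n != 0 -> (m <= n)%N.
  by rewrite /m; case: ex_minnP.
(* f(z) = z^m times the series of c', whose constant coefficient is not 0 *)
pose c' n := c (m + n)%N.
have hc' : gaussian c' M g.
  move=> n; apply: le_trans (hc _) _.
  have M0 : 0 <= M by apply: le_trans (hM 0%N); apply: mod_ge0.
  rewrite ler_wpM2l// ler_expR lerN2 ler_pM2l// lerXn2r ?nnegrE// ler_nat leq_addl//.
have tc' : transcendental c'.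
  split; [exact: gaussian_slow g0 hc' | by rewrite /c' addn0|].
  move=> N; have [n Nn cn] := cinf (m + N)%N.
  exists (n - m)%N; first by rewrite leq_subRL// (leq_trans (leq_addr _ _) Nn).
  by rewrite /c' subnKC// (leq_trans (leq_addr _ _) Nn).
have fE : qseries alpha logq fc = fun z => z ^+ m * psum c' z.
  apply/funext => z; rewrite -(psum_shift z sc)// => n nm.
  by apply/eqP; apply: contraTT nm => /mmin; rewrite -leqNgt.
move=> f; rewrite /f fE; split; first exact: infinite_roots.
split; first by exists (fun n => sorted_root c' n.-1); apply: sorted_root_arranged.
move=> rho hrho C eta hC /andP[eta0 eta1].
have [pos _ mono] := hrho.
have lq : 4 * alpha * ln (normc q) = - (4 * g) by rewrite /g /L; ring.
have C0 : 0 < C.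
  by apply: lt_trans hC; rewrite lq invrN mulrN opprK divr_gt0// mulr_gt0.
have kg : 0 < growth_rate eta C < g.
  rewrite /growth_rate; apply/andP; split.
    by rewrite divr_gt0// mulr_gt0 ?exprn_gt0// subr_gt0.
  rewrite ltr_pdivrMr//.
  have h : 1 < 4 * g * C.
    move: hC; rewrite lq invrN mulrN opprK ltr_pdivrMr; last by rewrite mulr_gt0.
    by rewrite mulrC.
  (* (1 - eta) eta <= 1/4 is the square below, and eta <= 1 *)
  have : (1 - eta) * eta ^+ 2 <= 1 / 4.
    have : 0 <= (1 - 2 * eta) ^+ 2 by apply: sqr_ge0.
    nra.
  lra.
have [_ c'0 _] := tc'.
have [N hN] := gaussian_zeros hc' c'0 kg.
exists N.+1 => // n Nn; rewrite leNgt; apply/negP => small.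
have rho_le i : (0 < i <= n)%N -> normc (rho i) <= normc (rho n).
  move=> /andP[i0 /subnKC <-]; elim: (n - i)%N => [|k IH]; first by rewrite addn0.
  by apply: le_trans IH _; rewrite addnS mono// addn_gt0 i0.
apply: (hN [seq rho i | i <- iota 1 n]); rewrite ?size_map ?size_iota.
- exact: ltnW.
- move=> a ha; have [a0 va] := arranged_vanish hrho ha.
  exact: vanish_expr_mul va.
- move=> _ /mapP[i hi ->]; apply: le_trans (ltW small); apply: rho_le.
  by move: hi; rewrite mem_iota add1n ltnS.
Qed.
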